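(* Let $A\in\mathbb{R}^{n\times n}$ be symmetric and $B\in\mathbb{R}^{n\times n}$ symmetric positive definite, and let $u\in\mathbb{R}^n$ satisfy $u^TABu\ne0$. For real $\gamma$, the equation $(u^TABu)\gamma^2+(u^TB^2u-u^TA^2u)\gamma-u^TABu=0$ is equivalent to $u^T(\gamma A+B)(A-\gamma B)u=0$. Consequently, the generalized homogeneous Rayleigh quotient $\alpha=\alpha_1/\alpha_2$ of $(A,B)$ at $u$ satisfies the nonlinear Galerkin condition $$(\alpha_2A-\alpha_1B)u\ \perp\ (\alpha_1A+\alpha_2B)u.$$
   Context: $\|\cdot\|$ is the Euclidean norm and $\perp$ denotes orthogonality in the standard inner product. For $u^TABu\neq0$ the generalized homogeneous Rayleigh quotient of $(A,B)$ at $u$ is $\alpha=\alpha_1/\alpha_2$, where $(\alpha_1,\alpha_2)$ is the unique minimizer of $\frac{\|\alpha_1Bu-\alpha_2Au\|}{\sqrt{\alpha_1^2+\alpha_2^2}}$ over the real projective line ($\mathbb{R}^2\setminus\{0\}$ modulo nonzero scalars); explicitly $$\alpha=\frac{1}{2\,u^TABu}\Big[u^TA^2u-u^TB^2u+\sqrt{(u^TA^2u-u^TB^2u)^2+4(u^TABu)^2}\Big].$$ *)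

(* Defs.v *)
From mathcomp Require Import all_boot all_order all_algebra.
From mathcomp Require Import ring lra.

Set Implicit Arguments.
Unset Strict Implicit.
Unset Printing Implicit Defensive.

Import Order.TTheory GRing.Theory Num.Theory.
Local Open Scope ring_scope.

(* Vectors of R^n are columns, so that [qform M u] is literally u^T M u. *)
Definition dotv (R : rcfType) (n : nat) (v w : 'cV[R]_n) : R :=
  (v^T *m w) 0 0.

Definition enorm (R : rcfType) (n : nat) (v : 'cV[R]_n) : R :=
  Num.sqrt (dotv v v).

Definition orthv (R : rcfType) (n : nat) (v w : 'cV[R]_n) : Prop :=
  dotv v w = 0.

Definition qform (R : rcfType) (n : nat) (M : 'M[R]_n) (u : 'cV[R]_n) : R :=
  (u^T *m M *m u) 0 0.

Definition sym_posdef (R : rcfType) (n : nat) (M : 'M[R]_n) : Prop :=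
  M \is symmetricmx /\ forall x : 'cV[R]_n, x != 0 -> 0 < qform M x.

Definition ghrq_residual (R : rcfType) (n : nat) (A B : 'M[R]_n)
    (u : 'cV[R]_n) (a1 a2 : R) : R :=
  enorm (a1 *: (B *m u) - a2 *: (A *m u)) / Num.sqrt (a1 ^+ 2 + a2 ^+ 2).

(* (a1, a2) are homogeneous coordinates of the generalized homogeneous Rayleigh
   quotient a1 / a2: a point of the real projective line, given by any of its
   nonzero representatives, at which the residual is minimal.  The minimizer
   exists, is unique up to scaling, and has a2 != 0 as soon as u^T A B u != 0:
   see [ghrq_coords_well_defined]. *)
Definition ghrq_coords (R : rcfType) (n : nat) (A B : 'M[R]_n)
    (u : 'cV[R]_n) (a1 a2 : R) : Prop :=
  (a1, a2) != (0, 0) /\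
  forall b1 b2 : R, (b1, b2) != (0, 0) ->
    ghrq_residual A B u a1 a2 <= ghrq_residual A B u b1 b2.

Lemma symmetricmx_tr (R : rcfType) (n : nat) (M : 'M[R]_n) :
  M \is symmetricmx -> M^T = M.
Proof.
by move/is_hermitianmxP => {2}->; rewrite expr0 scale1r map_mx_id.
Qed.

Lemma dotvE (R : rcfType) (n : nat) (v w : 'cV[R]_n) :
  dotv v w = \sum_i v i 0 * w i 0.
Proof. by rewrite /dotv mxE; apply: eq_bigr => i _; rewrite mxE. Qed.

Lemma dotv_ge0 (R : rcfType) (n : nat) (v : 'cV[R]_n) : 0 <= dotv v v.
Proof. by rewrite dotvE sumr_ge0 // => i _; rewrite -expr2 sqr_ge0. Qed.

Lemma dotv_comb (R : rcfType) (n : nat) (x y : 'cV[R]_n) (b1 b2 : R) :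
  dotv (b1 *: x - b2 *: y) (b1 *: x - b2 *: y) =
  b1 ^+ 2 * dotv x x - 2 * b1 * b2 * dotv y x + b2 ^+ 2 * dotv y y.
Proof.
rewrite !dotvE !mulr_sumr -sumrB -big_split /=.
by apply: eq_bigr => i _; rewrite !mxE; ring.
Qed.

Lemma qform_dotv (R : rcfType) (n : nat) (M N : 'M[R]_n) (u : 'cV[R]_n) :
  M \is symmetricmx -> qform (M *m N) u = dotv (M *m u) (N *m u).
Proof.
by move=> /symmetricmx_tr hM; rewrite /qform /dotv trmx_mul hM !mulmxA.
Qed.

Lemma pair_neq0 (R : rcfType) (b1 b2 : R) :
  ((b1, b2) != (0, 0)) = (0 < b1 ^+ 2 + b2 ^+ 2).
Proof.
rewrite lt0r addr_ge0 ?sqr_ge0 // andbT.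
by rewrite paddr_eq0 ?sqr_ge0 // !sqrf_eq0.
Qed.

Lemma ghrq_coords_well_defined (R : rcfType) (n : nat) (A B : 'M[R]_n)
    (u : 'cV[R]_n) :
  A \is symmetricmx -> sym_posdef B -> qform (A *m B) u != 0 ->
  exists a1 a2 : R,
    [/\ ghrq_coords A B u a1 a2,
        forall b1 b2 : R, ghrq_coords A B u b1 b2 ->
          exists2 c : R, c != 0 & b1 = c * a1 /\ b2 = c * a2,
        a2 != 0 &
        a1 / a2 =
          (2 * qform (A *m B) u)^-1 *
          (qform (A *m A) u - qform (B *m B) u +
           Num.sqrt ((qform (A *m A) u - qform (B *m B) u) ^+ 2 +
                     4 * qform (A *m B) u ^+ 2))].
Proof.
move=> hA [hB _]; rewrite !qform_dotv //.
have normE b1 b2 := dotv_comb (B *m u) (A *m u) b1 b2.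
set r := dotv (A *m u) (A *m u) in normE *.
set p := dotv (B *m u) (B *m u) in normE *.
set q := dotv (A *m u) (B *m u) in normE * => q0.
have resE b1 b2 : (b1, b2) != (0, 0) -> ghrq_residual A B u b1 b2 =
   Num.sqrt ((b1 ^+ 2 * p - 2 * b1 * b2 * q + b2 ^+ 2 * r) /
             (b1 ^+ 2 + b2 ^+ 2)).
  move=> hb; rewrite /ghrq_residual /enorm -normE sqrtrM ?dotv_ge0 //.
  by rewrite sqrtrV // ltW // -pair_neq0.
have quot_ge0 b1 b2 :
    0 <= (b1 ^+ 2 * p - 2 * b1 * b2 * q + b2 ^+ 2 * r) / (b1 ^+ 2 + b2 ^+ 2).
  by rewrite -normE divr_ge0 ?dotv_ge0 // addr_ge0 ?sqr_ge0.
set D := (r - p) ^+ 2 + 4 * q ^+ 2; set S := Num.sqrt D.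
have q2 : 0 < q ^+ 2 by rewrite exprn_even_gt0.
have D0 : 0 <= D by rewrite addr_ge0 ?sqr_ge0 // mulr_ge0 // ltW.
have S2 : S ^+ 2 = D by rewrite sqr_sqrtr.
have S0 : 0 <= S by rewrite sqrtr_ge0.
pose x := (p - r + S) / 2; pose y := (r - p + S) / 2.
pose lam := (p + r - S) / 2.
have xy : x * y = q ^+ 2.
  have -> : x * y = (S ^+ 2 - (r - p) ^+ 2) / 4 by rewrite /x /y; field.
  by rewrite S2 /D; field.
have x0 : 0 < x.
  have hxy : 0 <= x + y by rewrite /x /y; lra.
  rewrite ltNge; apply/negP => x_le0.
  have y_ge0 : 0 <= y by lra.
  have : x * y <= 0 by rewrite mulr_le0_ge0.
  by rewrite xy leNgt q2.
have keyE b1 b2 : (b1, b2) != (0, 0) ->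
    (b1 ^+ 2 * p - 2 * b1 * b2 * q + b2 ^+ 2 * r) / (b1 ^+ 2 + b2 ^+ 2) =
    lam + (x * b1 - q * b2) ^+ 2 / (x * (b1 ^+ 2 + b2 ^+ 2)).
  rewrite pair_neq0 => hb.
  have -> : (x * b1 - q * b2) ^+ 2 =
            x * (x * b1 ^+ 2 - 2 * q * b1 * b2 + y * b2 ^+ 2).
    have -> : (x * b1 - q * b2) ^+ 2 =
      x * (x * b1 ^+ 2 - 2 * q * b1 * b2) + q ^+ 2 * b2 ^+ 2 by ring.
    by rewrite -xy; ring.
  have hw := lt0r_neq0 hb; rewrite -mulf_div divff ?lt0r_neq0 // mul1r.
  apply/eqP; rewrite -[lam](mulfK hw) -mulrDl (inj_eq (mulIf _)) ?invr_eq0 //.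
  by apply/eqP; rewrite /lam /x /y; field.
exists y, q.
have hyq : (y, q) != (0, 0).
  by rewrite pair_neq0 ltr_wpDl ?sqr_ge0.
have valyq : x * y - q * q = 0 by rewrite xy expr2 subrr.
have rem_ge0 b1 b2 : 0 <= (x * b1 - q * b2) ^+ 2 / (x * (b1 ^+ 2 + b2 ^+ 2)).
  by rewrite divr_ge0 ?sqr_ge0 // mulr_ge0 ?addr_ge0 ?sqr_ge0 // ltW.
split => //.
- split=> // b1 b2 hb; rewrite !resE // ler_sqrt ?quot_ge0 // !keyE //.
  by rewrite valyq expr0n /= mul0r lerD2l.
- move=> b1 b2 [hb /(_ y q hyq)].
  rewrite !resE // ler_sqrt ?quot_ge0 // !keyE //.
  rewrite valyq expr0n /= mul0r lerD2l => rem_le0.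
  have {rem_le0} : (x * b1 - q * b2) ^+ 2 / (x * (b1 ^+ 2 + b2 ^+ 2)) == 0.
    by rewrite eq_le rem_le0 rem_ge0.
  have den : x * (b1 ^+ 2 + b2 ^+ 2) != 0.
    by rewrite lt0r_neq0 // mulr_gt0 // -pair_neq0.
  rewrite mulf_eq0 invr_eq0 (negbTE den) orbF sqrf_eq0 subr_eq0 => /eqP e.
  have e1 : b1 = b2 / q * y.
    apply: (mulfI (lt0r_neq0 x0)).
    have -> : x * (b2 / q * y) = b2 / q * (x * y) by ring.
    by rewrite e xy; field.
  exists (b2 / q); last by split; rewrite ?divfK.
  apply: contraNneq hb => c0.
  have e2 : b2 = 0 by rewrite -(divfK q0 b2) c0 mul0r.
  by rewrite e1 c0 mul0r e2.
- by rewrite /y; field.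
Qed.

(* Main.v *)
Require Import Defs.
From mathcomp Require Import all_boot all_order all_algebra.
From mathcomp Require Import ring.
Import Order.TTheory GRing.Theory Num.Theory.
Local Open Scope ring_scope.

(** Everything is read off inner products of [A u] and [B u]. By symmetry the form in gamma is the
    inner product of [(gamma A + B) u] and [(A - gamma B) u], which [dotv_comb2] expands to minus
    the quadratic. The Galerkin product is the same expression homogenized, minus [alpha2 ^+ 2]
    times the quadratic at [alpha1 / alpha2]; it vanishes because that ratio is a root, by
    [quadratic_formula_root]. *)

Lemma qform_trmul (R : rcfType) (n : nat) (M N : 'M[R]_n) (u : 'cV[R]_n) :
  qform (M^T *m N) u = dotv (M *m u) (N *m u).
Proof. by rewrite /qform /dotv trmx_mul !mulmxA. Qed.

Lemma dotv_comb2 (R : rcfType) (n : nat) (x y : 'cV[R]_n) (a b c d : R) :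
  dotv (a *: x + b *: y) (c *: x + d *: y) =
  a * c * dotv x x + (a * d + b * c) * dotv x y + b * d * dotv y y.
Proof.
rewrite !dotvE !mulr_sumr -!big_split /=.
by apply: eq_bigr => i _; rewrite !mxE; ring.
Qed.

(** The discriminant is a sum of squares, so the square root is genuine. Here [d] stands for the
    difference of the forms of [A *m A] and [B *m B], and [g] for the explicit quotient. *)
Lemma quadratic_formula_root (R : rcfType) (q d : R) : q != 0 ->
  let g := (2 * q)^-1 * (d + Num.sqrt (d ^+ 2 + 4 * q ^+ 2)) in
  q * g ^+ 2 - d * g - q = 0.
Proof.
move=> q0 /=; set S := Num.sqrt _.
have S2 : S ^+ 2 = d ^+ 2 + 4 * q ^+ 2.
  by apply: sqr_sqrtr; rewrite addr_ge0 ?sqr_ge0 // mulr_ge0 ?sqr_ge0.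
have -> : q * ((2 * q)^-1 * (d + S)) ^+ 2 - d * ((2 * q)^-1 * (d + S)) - q =
  (S ^+ 2 - (d ^+ 2 + 4 * q ^+ 2)) / (4 * q) by field.
by rewrite S2 subrr mul0r.
Qed.

Theorem mainTheorem9 (R : rcfType) (n : nat) (A B : 'M[R]_n) (u : 'cV[R]_n)
    (hA : A \is symmetricmx) (hB : sym_posdef B)
    (hu : qform (A *m B) u != 0) :
  (forall gamma : R,
     qform (A *m B) u * gamma ^+ 2
       + (qform (B *m B) u - qform (A *m A) u) * gamma
       - qform (A *m B) u = 0
     <-> qform ((gamma *: A + B) *m (A - gamma *: B)) u = 0) /\
  (forall alpha1 alpha2 : R,
     ghrq_coords A B u alpha1 alpha2 ->
     orthv ((alpha2 *: A - alpha1 *: B) *m u)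
           ((alpha1 *: A + alpha2 *: B) *m u)).
Proof.
have hBs := hB.1; split=> [gamma | b1 b2 hb].
(* The transpose lets [qform_trmul] move the left factor onto the first vector. *)
- have -> : gamma *: A + B = (gamma *: A + B)^T.
    by rewrite linearD linearZ /= !symmetricmx_tr.
  rewrite qform_trmul !qform_dotv // mulmxDl mulmxBl -!scalemxAl.
  have := dotv_comb2 _ _ (A *m u) (B *m u) gamma 1 1 (- gamma).
  rewrite !scale1r scaleNr => ->.
  set lhs := (X in X = 0 <-> _); set rhs := (X in _ <-> X = 0).
  have -> : rhs = - lhs by rewrite /lhs /rhs; ring.
  by split=> [-> | /eqP]; rewrite ?oppr0 // oppr_eq0 => /eqP.
(* Any minimizer is a multiple of one whose ratio is given by the explicit formula. *)
have [a1 [a2 [_ proportional a2n0 ratio]]] :=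
  ghrq_coords_well_defined hA hB hu.
have [c _ [eb1 eb2]] := proportional _ _ hb; rewrite eb1 eb2 {b1 b2 hb eb1 eb2}.
have := quadratic_formula_root _ _ (qform (A *m A) u - qform (B *m B) u) hu.
rewrite /= -ratio !qform_dotv // => root.
rewrite /orthv mulmxBl mulmxDl -!scalemxAl -scaleNr dotv_comb2.
(* The right-hand zero becomes [- (c * a2) ^+ 2] times the quadratic at [a1 / a2]; clearing the
   denominator [a2] leaves a polynomial identity. *)
rewrite -[RHS](mulr0 (- (c * a2) ^+ 2)) -root.
by field.
Qed.
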